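(* For every positive integer $d$, $\sigma([-1,1]^d)=\frac{1}{2}$.
   Context: A subset $S\subset\mathbb{R}^d$ is sum-free if there are no $a,b,c\in S$ (not necessarily distinct) with $a+b=c$. For a bounded convex region $R\subset\mathbb{R}^d$ with nonempty interior, let $\mu_R$ be the uniform probability measure on $R$, i.e. $\mu_R(S)=\lambda(S\cap R)/\lambda(R)$, where $\lambda$ is the $d$-dimensional Lebesgue measure. Define $$\sigma(R)=\sup\{\mu_R(S) : S\subset\mathbb{R}^d \text{ is Borel and sum-free}\}.$$ *)

(* Defs.v *)
From HB Require Import structures.
From mathcomp Require Import all_boot all_order all_algebra.
From mathcomp Require Import all_classical all_reals all_analysis.
From mathcomp Require Import measurable_realfun.

Set Implicit Arguments.
Unset Strict Implicit.
Unset Printing Implicit Defensive.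

Import Order.TTheory GRing.Theory Num.Theory.
Import numFieldNormedType.Exports.

Local Open Scope classical_set_scope.
Local Open Scope ring_scope.

(* R^n with its Borel sigma-algebra, generated by the open sets *)
Notation borel_rV R n := (g_sigma_algebraType (@open 'rV[R]_n)).

Definition cons_rV (R : realType) (n : nat)
    (p : measurableTypeR R * borel_rV R n) : borel_rV R n.+1 :=
  (row_mx (p.1%:M : 'rV[R]_1) p.2 : 'rV[R]_(1 + n)).

(* Lebesgue measure on R^n as the n-fold product of Lebesgue measure on R;
   lebesgue_rV_box below gives the volume of boxes *)
Fixpoint lebesgue_rV (R : realType) (n : nat) : set (borel_rV R n) -> \bar R :=
  match n with
  | 0 => \d_(0 : borel_rV R 0)
  | m.+1 => pushforward
      (@lebesgue_measure R \x @lebesgue_rV R m)%E (@cons_rV R m)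
  end.

Section lebesgue_rV_measure.
Context {R : realType}.

Lemma cons_rV0 n (p : measurableTypeR R * borel_rV R n) i :
  (cons_rV p : 'rV[R]_n.+1) i 0 = p.1.
Proof.
have := @row_mxEl R 1 1 n (p.1%:M) p.2 i 0.
by rewrite (_ : lshift n 0 = 0) ?mxE ?(ord1 i) ?eqxx ?mulr1n//; exact/val_inj.
Qed.

Lemma cons_rVS n (p : measurableTypeR R * borel_rV R n) i (j : 'I_n) :
  (cons_rV p : 'rV[R]_n.+1) i (lift ord0 j) = (p.2 : 'rV[R]_n) i j.
Proof.
have := @row_mxEr R 1 1 n (p.1%:M) p.2 i j.
by rewrite (_ : rshift 1 j = lift ord0 j)//; exact/val_inj.
Qed.

Lemma open_rV_rat_ball n (U : set 'rV[R]_n) (x : 'rV[R]_n) : open U -> U x ->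
  exists q : 'rV[rat]_n * rat,
    ball (map_mx ratr q.1 : 'rV[R]_n) (ratr q.2) x /\
    ball (map_mx ratr q.1 : 'rV[R]_n) (ratr q.2) `<=` U.
Proof.
move=> oU Ux; have /nbhs_ballP[e /= e0 xeU] : nbhs x U by exact: open_nbhs_nbhs.
have e20 : 0 < e / 2 by rewrite divr_gt0.
have [r] := rat_in_itvoo e20; rewrite in_itv/= => /andP[r0 re].
have H j : exists q : rat, ball (ratr q : R) (ratr r) (x 0 j).
  have [|q] := @rat_in_itvoo R (x 0 j - ratr r) (x 0 j + ratr r).
    by rewrite ltrD2l gtrN.
  rewrite in_itv/= => /andP[h1 h2]; exists q.
  by rewrite /ball/= distrC ltr_distlC h1 h2.
have [q hq] := choice H.
exists (\row_j q j, r) => /=.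
have Bx : ball (map_mx ratr (\row_j q j) : 'rV[R]_n) (ratr r) x.
  by split=> // i j; rewrite (ord1 i) !mxE; exact: hq.
split=> // y By; apply: xeU; rewrite (splitr e).
apply: (@ball_triangle _ _ (map_mx ratr (\row_j q j) : 'rV[R]_n)).
  by apply: ball_sym; exact: le_ball (ltW re) _ Bx.
exact: le_ball (ltW re) _ By.
Qed.

Lemma measurable_cons_rV n : measurable_fun setT (@cons_rV R n).
Proof.
apply: (@measurability _ _ _ (borel_rV R n.+1) _ _ (@open 'rV[R]_n.+1) erefl).
move=> _ [U oU <-]; rewrite setTI.
pose cB (q : 'rV[rat]_n.+1 * rat) :=
  ball (map_mx ratr q.1 : 'rV[R]_n.+1) (ratr q.2 : R).
pose W (q : 'rV[rat]_n.+1 * rat) : set (measurableTypeR R * borel_rV R n) :=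
  if `[< cB q `<=` U >] then
   ball (ratr (q.1 0 0) : R) (ratr q.2 : R) `*`
   ball (map_mx ratr (\row_j q.1 0 (lift ord0 j)) : 'rV[R]_n) (ratr q.2 : R)
  else set0.
have WE q p : 0 < (ratr q.2 : R) -> cB q (cons_rV p) <->
   (ball (ratr (q.1 0 0) : R) (ratr q.2 : R) `*`
   ball (map_mx ratr (\row_j q.1 0 (lift ord0 j)) : 'rV[R]_n) (ratr q.2 : R)) p.
  move=> q0; split.
    move=> [_ h]; split; first by have := h 0 0; rewrite cons_rV0 !mxE.
    split=> // i j; have := h 0 (lift ord0 j).
    by rewrite cons_rVS (ord1 i) !mxE.
  move=> [/= h1 [_ h2]]; split=> // i j; rewrite (ord1 i).
  have [k ->|->] := unliftP ord0 j; last by rewrite cons_rV0 mxE.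
  by rewrite cons_rVS mxE; have := h2 0 k; rewrite !mxE.
rewrite (_ : _ @^-1` _ = \bigcup_q W q).
  apply: countable_bigcupT_measurable => // q.
  rewrite /W; case: ifPn => // _.
  have [q0|q0] := ltP 0 (ratr q.2 : R).
    apply: measurableX; first by apply: open_measurable; exact: ball_open.
    by apply: sub_sigma_algebra; exact: ball_open.
  rewrite (_ : _ `*` _ = set0)// -subset0 => p [/= + _].
  by move=> /(le_lt_trans (normr_ge0 _)); rewrite ltNge q0.
apply/seteqP; split=> [p /= Up|p [q _]].
  have [q [qp qU]] := open_rV_rat_ball oU Up.
  exists q => //; rewrite /W asboolT//; apply/WE => //.
  by case: qp.
rewrite /W; case: ifPn => // /asboolP qU h; apply: qU; apply/WE => //.
by case: h => _ [].
Qed.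

HB.instance Definition _ n := isMeasurableFun.Build _ _ _ _
  (@cons_rV R n) (@measurable_cons_rV n).

Lemma measurable_coord_rV n (i : 'I_n) :
  measurable_fun setT
    (fun u : borel_rV R n => (u : 'rV[R]_n) 0 i : measurableTypeR R).
Proof.
apply: (measurability _ (RGenOpens.measurableE R)) => _ [_ [a [b ->]] <-].
rewrite setTI; apply: sub_sigma_algebra.
have /continuousP := @coord_continuous R 1 n 0 i.
by apply; exact: interval_open.
Qed.

Lemma measurable_box_rV n (A : 'I_n -> set R) :
  (forall i, measurable (A i)) ->
  measurable
    ([set u | forall i, A i ((u : 'rV[R]_n) 0 i)] : set (borel_rV R n)).
Proof.
move=> mA.
rewrite (_ : [set _ | _] =
    \bigcap_(i in [set: 'I_n]) [set u | A i ((u : 'rV[R]_n) 0 i)]).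
  apply: fin_bigcap_measurable => // i _.
  rewrite -[X in measurable X]setTI.
  exact: (measurable_coord_rV i measurableT (mA i)).
by apply/seteqP; split=> [u h i _|u h i]; exact: h.
Qed.

Let lebesgue_rV_subproof n :
  (exists mu : {sigma_finite_measure set (borel_rV R n) -> \bar R},
    mu = @lebesgue_rV R n :> (set _ -> _)) /\
  (forall A : 'I_n -> set R, (forall i, measurable (A i)) ->
    lebesgue_rV ([set u | forall i, A i ((u : 'rV[R]_n) 0 i)]) =
    (\prod_(i < n) lebesgue_measure (A i))%E).
Proof.
elim: n => [|n [[mu muE] box]].
  split; first by exists (\d_(0 : borel_rV R 0)).
  by move=> A mA; rewrite big_ord0/= diracE mem_set//= => -[].
have boxS (A : 'I_n.+1 -> set R) : (forall i, measurable (A i)) ->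
    lebesgue_rV ([set u | forall i, A i ((u : 'rV[R]_n.+1) 0 i)]) =
    (\prod_(i < n.+1) lebesgue_measure (A i))%E.
  move=> mA; rewrite big_ord_recl -box//= -muE /pushforward.
  rewrite -product_measure1E; first last.
    exact: (measurable_box_rV (fun i => mA (lift ord0 i))).
    exact: mA.
  congr ((_ \x _)%E _); apply/seteqP; split=> p /=.
    move=> h; split=> [|i]; first by have := h 0; rewrite cons_rV0.
    by have := h (lift ord0 i); rewrite cons_rVS.
  move=> [h1 h2] i; have [k ->|->] := unliftP ord0 i; last by rewrite cons_rV0.
  by rewrite cons_rVS; exact: h2.
split=> //.
pose mu1 : set (borel_rV R n.+1) -> \bar R :=
  pushforward (@lebesgue_measure R \x mu)%E (@cons_rV R n).
have mu1E : mu1 = @lebesgue_rV R n.+1 by rewrite /mu1 muE.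
have sf : sigma_finite setT mu1.
  exists (fun k => [set u | forall i,
      `[- k%:R, k%:R]%classic ((u : 'rV[R]_n.+1) 0 i)]).
    apply/esym; rewrite -subTset => u _.
    exists (Num.truncn `|u : 'rV[R]_n.+1|).+1 => //.
    move=> i /=; rewrite in_itv/= -ler_norml ltW//.
    apply: le_lt_trans (truncnS_gt _).
    rewrite -[leRHS]/(mx_norm (u : 'rV[R]_n.+1)) mx_normrE.
    exact: (le_bigmax _ (fun ij => `|(u : 'rV[R]_n.+1) ij.1 ij.2|) (0, i)).
  move=> k; pose I := `[- k%:R, k%:R]%classic : set R.
  have mI (i : 'I_n.+1) : measurable I by exact: measurable_itv.
  split; first exact: (measurable_box_rV mI).
  rewrite mu1E (boxS (fun=> I))//.
  have : (\prod_(i < n.+1) lebesgue_measure I)%E \is a fin_num.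
    by apply: prode_fin_num => i _; rewrite lebesgue_measure_itv/=; case: ifPn.
  by rewrite fin_numE ltey => /andP[].
have mu1_0 : mu1 set0 = 0%E
  by rewrite /mu1/= /pushforward preimage_set0 measure0.
have mu1_ge0 A : (0 <= mu1 A)%E by exact: measure_ge0.
have mu1_sigma_additive : semi_sigma_additive mu1.
  move=> F mF tF mUF; apply: (@measure_semi_sigma_additive _ _ _
    (pushforward (@lebesgue_measure R \x mu)%E (@cons_rV R n))) => //.
pose mu1m := isMeasure.Build _ _ _ mu1 mu1_0 mu1_ge0 mu1_sigma_additive.
pose mu2 : {measure set (borel_rV R n.+1) -> \bar R} := HB.pack mu1 mu1m.
pose mu3m := Measure_isSigmaFinite.Build _ _ _ mu2 sf.
pose mu3 : {sigma_finite_measure set (borel_rV R n.+1) -> \bar R} :=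
  HB.pack mu1 mu1m mu3m.
by exists mu3; exact: mu1E.
Qed.

Lemma lebesgue_rV_box n (A : 'I_n -> set R) : (forall i, measurable (A i)) ->
  lebesgue_rV [set u | forall i, A i ((u : 'rV[R]_n) 0 i)] =
  (\prod_(i < n) lebesgue_measure (A i))%E.
Proof. exact: (lebesgue_rV_subproof n).2. Qed.

Let lebesgue_rV0 n : @lebesgue_rV R n set0 = 0%E.
Proof. by have [[mu <-] _] := lebesgue_rV_subproof n; exact: measure0. Qed.

Let lebesgue_rV_ge0 n A : (0 <= @lebesgue_rV R n A)%E.
Proof. by have [[mu <-] _] := lebesgue_rV_subproof n; exact: measure_ge0. Qed.

Let lebesgue_rV_sigma_additive n : semi_sigma_additive (@lebesgue_rV R n).
Proof.
by have [[mu <-] _] := lebesgue_rV_subproof n;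
  exact: measure_semi_sigma_additive.
Qed.

HB.instance Definition _ n := isMeasure.Build _ _ _ (@lebesgue_rV R n)
  (@lebesgue_rV0 n) (@lebesgue_rV_ge0 n) (@lebesgue_rV_sigma_additive n).

Let lebesgue_rV_sigma_finite n : sigma_finite setT (@lebesgue_rV R n).
Proof. by have [[mu <-] _] := lebesgue_rV_subproof n; exact: sigma_finiteT. Qed.

HB.instance Definition _ n := Measure_isSigmaFinite.Build _ _ _
  (@lebesgue_rV R n) (@lebesgue_rV_sigma_finite n).

End lebesgue_rV_measure.

Definition sum_free (V : zmodType) (S : set V) : Prop :=
  forall a b c : V, S a -> S b -> S c -> a + b <> c.

Definition unif_meas (R : realType) (n : nat) (D S : set 'rV[R]_n) : \bar R :=
  (lebesgue_rV (S `&` D) / lebesgue_rV D)%E.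

Definition sigma (R : realType) (n : nat) (D : set 'rV[R]_n) : \bar R :=
  ereal_sup [set unif_meas D S | S in
    [set S : set 'rV[R]_n |
      measurable (S : set (borel_rV R n)) /\ sum_free S]].

Definition cube (R : realType) (n : nat) : set 'rV[R]_n :=
  [set x : 'rV[R]_n | forall i, x 0 i \in `[-1, 1]].
Arguments cube : clear implicits.

(* Main.v *)
Require Import Defs.
From HB Require Import structures.
From mathcomp Require Import all_boot all_order all_algebra.
From mathcomp Require Import all_classical all_reals all_analysis.
From mathcomp Require Import measurable_realfun.
From mathcomp Require Import ring lra.

(** Let [K = [-1, 1]^d], let [T] be the trace on [K] of a sum-free set, and put
[E = T `&` -T] and [N = K `\` (T `|` -T)], so that [2 |T| = |K| + |E| - |N|].
Since [E = -E], sum-freeness forces [(E - E) `&` K] into [N], and it remains to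
see that [|(E - E) `&` K| >= |E|].  Inside each of the [2^d] unit cubes [Q] cut
out of [K] by the coordinate hyperplanes, [X = E `&` Q] satisfies
[X - X `<=` K], and [|X - X| >= 2^d |X|] by Brunn-Minkowski; summing over [Q]
gives the claim.  The bound is attained by the points whose first coordinate
exceeds 1/2 in absolute value. *)

Set Implicit Arguments.
Unset Strict Implicit.
Unset Printing Implicit Defensive.

Import Order.TTheory GRing.Theory Num.Theory.
Import numFieldNormedType.Exports.

Local Open Scope classical_set_scope.
Local Open Scope ring_scope.

(** * Translation invariance and the Brunn-Minkowski inequality on the line *)

Section real_line.
Context {R : realType}.
Local Notation mu := (@lebesgue_measure R).
Local Notation GR := (measurableTypeR R).

Lemma measurable_shift (A : set GR) (c : R) :
  measurable A -> measurable ((fun x : R => x + c) @^-1` A : set GR).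
Proof.
move=> mA; rewrite -[X in measurable X]setTI.
by have := @measurable_funD _ GR R setT idfun (cst c) (@measurable_id _ _ _)
  (measurable_cst _); apply.
Qed.

Lemma lebesgue_measure_shift (A : set GR) (c : R) :
  measurable A -> mu ((fun x : R => x + c) @^-1` A) = mu A.
Proof.
move=> mA.
have mf : measurable_fun setT ((fun x : R => x + c) : GR -> GR).
  by move=> _ Y mY; rewrite setTI; exact: measurable_shift.
pose f : {mfun GR >-> GR} := HB.pack ((fun x : R => x + c) : GR -> GR)
  (isMeasurableFun.Build _ _ _ _ _ mf).
apply/esym/(@lebesgue_measure_unique R (pushforward mu f)) => // _ [[a b]] _ <-.
transitivity (mu `]a - c, b - c]%classic).
  rewrite !lebesgue_measure_itv/= !lte_fin ltrD2r -!EFinB.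
  by case: ifP => // _; congr (_%:E); lra.
apply: (congr1 mu); apply/seteqP; split=> x /=.
  by rewrite !in_itv/= ltrBlDr lerBrDr.
by rewrite !in_itv/= ltrBlDr lerBrDr.
Qed.

(** Take [a] in [A] near [sup A] and [b] in [B] near [inf B]. The translates [A + b] and [a + B]
    both lie in [C], and they overlap only in a short interval. Using a measurable [C] that contains
    all the sums avoids the question whether the sumset is measurable. *)
Lemma lebesgue_measure_sumset (A B C : set GR) :
  measurable A -> measurable B -> measurable C ->
  A !=set0 -> B !=set0 -> has_ubound A -> has_lbound B ->
  (forall a b, A a -> B b -> C (a + b)) -> (mu A + mu B <= mu C)%E.
Proof.
move=> mA mB mC A0 B0 uA lB ABC.
apply/lee_addgt0Pr => e e0.
have e2 : 0 < e / 2 by rewrite divr_gt0.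
have [a Aa age] := @sup_adherent R A _ e2 (conj A0 uA).
have [b Bb bge] := @inf_adherent R B _ e2 (conj B0 lB).
pose P := (fun x : R => x + (- b)) @^-1` A.
pose Q := (fun x : R => x + (- a)) @^-1` B.
have mP : measurable (P : set GR) by exact: measurable_shift.
have mQ : measurable (Q : set GR) by exact: measurable_shift.
have -> : mu A = mu P by rewrite lebesgue_measure_shift.
have -> : mu B = mu Q by rewrite lebesgue_measure_shift.
have QE : Q = (Q `\` P) `|` (Q `&` P) by rewrite setUC setUIDK.
(* [P] is [A + b] and [Q] is [a + B]. The interval has length [(sup A - a) + (b - inf B)], which is
   less than [e] by the choice of [a] and [b]. *)
have sQP : Q `&` P `<=` `[a + inf B, sup A + b]%classic.
  move=> x [Qx Px] /=; rewrite in_itv/=; apply/andP; split.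
    by have := ge_inf lB Qx; lra.
  by have := ub_le_sup uA Px; lra.
have mQP : measurable (Q `\` P : set GR) by exact: measurableD.
have le1 : (mu Q <= mu (Q `\` P) + e%:E)%E.
  rewrite {1}QE measureU//; first last.
  - by rewrite setDE setIACA setICl setI0.
  - exact: measurableI.
  rewrite leeD2l//; apply: (@le_trans _ _ (mu `[a + inf B, sup A + b]%classic)).
    apply: le_measure => //; rewrite inE; last exact: measurable_itv.
    exact: (@measurableI _ GR).
  rewrite lebesgue_measure_itv/=; case: ifPn => _; last by rewrite lee_fin ltW.
  by rewrite -EFinB lee_fin; lra.
apply: (@le_trans _ _ (mu P + (mu (Q `\` P) + e%:E))%E); first exact: leeD2l.
rewrite addeA leeD2r// -measureU//; last by rewrite setDIK.
apply: le_measure; rewrite ?inE//; first exact: measurableU.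
move=> x [Px|[Qx _]].
  by rewrite -(subrK b x); exact: ABC.
by rewrite -(subrK a x) addrC; exact: ABC.
Qed.

End real_line.

(** * Layer-cake formula, and comparison of integrals through superlevel sets *)

Section superlevel.
Context d (T : measurableType d) (R : realType).
Context (m : {sigma_finite_measure set T -> \bar R}) (f : T -> \bar R).
Hypothesis mf : measurable_fun setT f.

Lemma measurable_hypograph :
  measurable [set p : T * measurableTypeR R | p.2%:E < f p.1]%E.
Proof.
have : measurable_fun setT (fun p : T * measurableTypeR R => p.2%:E < f p.1)%E.
  apply: measurable_fun_lte; last exact: measurableT_comp.
  exact/measurable_EFinP.
by move=> /(_ measurableT [set true]); rewrite setTI; exact.
Qed.

Let ysection_hypograph (s : R) :
  ysection [set p : T * measurableTypeR R | p.2%:E < f p.1]%E s =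
  [set x | s%:E < f x]%E.
Proof. by apply/seteqP; split=> x; rewrite /ysection/= inE. Qed.

Lemma measurable_superlevel (s : R) : measurable [set x | s%:E < f x]%E.
Proof.
rewrite -ysection_hypograph; apply: measurable_ysection.
exact: measurable_hypograph.
Qed.

Lemma measurable_fun_superlevel : measurable_fun setT
  (fun s : measurableTypeR R => m [set x | s%:E < f x]%E).
Proof.
have := measurable_fun_ysection m measurable_hypograph.
congr measurable_fun; apply/funext => s.
by rewrite -ysection_hypograph.
Qed.

(** Tonelli's theorem for the indicator of the region [G] between level 0 and the graph of [f]: its
    section over [x] is an interval of length [f x], and its section at a level [s >= 0] is a
    superlevel set. *)
Lemma layer_cake : (forall x, 0 <= f x)%E ->
  (\int[m]_x f x =
   \int[@lebesgue_measure R]_(s in `[0%R, +oo[) m [set x | s%:E < f x])%E.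
Proof.
move=> f0; pose GR := measurableTypeR R.
pose G := [set p : T * GR | 0 <= p.2 /\ (p.2%:E < f p.1)%E].
have mG : measurable G.
  apply: measurableI; last exact: measurable_hypograph.
  have : measurable_fun setT (fun p : T * GR => 0 <= p.2)
    by exact: measurable_fun_ler.
  by move=> /(_ measurableT [set true]); rewrite setTI; exact.
transitivity (\int[m]_x (\int[@lebesgue_measure R]_s (\1_G (x, s))%:E))%E.
  apply: eq_integral => x _.
  have mGx : measurable (xsection G x) by exact: measurable_xsection.
  rewrite (_ : (fun s : R => (\1_G (x, s))%:E) =
    EFin \o \1_(xsection G x)); last first.
    by apply/funext => s /=; rewrite !indicE mem_xsection.
  rewrite integral_indic// setIT.
  have := f0 x; case fx : (f x) => [r| |]// r0.
    rewrite (_ : xsection G x = `[0, r[%classic); last first.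
      apply/seteqP; split=> s; rewrite /xsection/= inE /G/= fx in_itv/= lte_fin;
        by move/andP.
    rewrite /= lebesgue_measure_itv/= lte_fin; rewrite sube0.
    by case: ltP => // r0'; congr (_%:E); apply/eqP; rewrite eq_le r0' -lee_fin.
  rewrite (_ : xsection G x = `[0, +oo[%classic).
    by rewrite /= lebesgue_measure_itv/= ltry.
  apply/seteqP; split=> s; rewrite /xsection/= inE /G/= fx in_itv/= ?andbT ltry.
    by case.
  by [].
rewrite (fubini_tonelli (fun p : T * GR => (\1_G p)%:E))//=; last first.
  exact/measurable_EFinP/measurable_indic.
rewrite [RHS]integral_mkcond; apply: eq_integral => s _; rewrite patchE.
rewrite (_ : (fun x => (\1_G (x, s))%:E) =
  EFin \o \1_(ysection G s)); last first.
  by apply/funext => x /=; rewrite !indicE mem_ysection.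
rewrite integral_indic//; last exact: measurable_ysection.
rewrite setIT; have [s0|s0] := leP 0 s.
  rewrite mem_set/= ?in_itv/= ?s0//.
  congr (m _); apply/seteqP; split=> x; rewrite /ysection/= inE /G/= => //.
  by case.
rewrite memNset/= ?in_itv/= ?leNgt ?s0//.
rewrite (_ : ysection G s = set0) ?measure0// -subset0 => x.
by rewrite /ysection/= inE /G/= leNgt s0 => -[].
Qed.

End superlevel.

(* Thanks to the equality of the suprema, the superlevel sets of [f] and [g] are
nonempty at the same levels, where the one-dimensional sumset bound applies. *)
Lemma integral_minkowski_eq_sup (R : realType) (f g h : R -> \bar R) :
  let mu := @lebesgue_measure R in
  measurable_fun setT (f : measurableTypeR R -> _) ->
  measurable_fun setT (g : measurableTypeR R -> _) ->
  measurable_fun setT (h : measurableTypeR R -> _) ->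
  (forall x, 0 <= f x)%E -> (forall x, 0 <= g x)%E -> (forall x, 0 <= h x)%E ->
  has_ubound [set x | 0 < f x]%E -> has_lbound [set x | 0 < g x]%E ->
  ereal_sup (range f) = ereal_sup (range g) ->
  (forall x y, (mine (f x) (g y) <= h (x + y)%R)%E) ->
  (\int[mu]_x f x + \int[mu]_x g x <= \int[mu]_x h x)%E.
Proof.
move=> mu mf mg mh f0 g0 h0 [uf ubf] [lg lbg] fg fgh.
have mlev := measurable_fun_superlevel mu.
rewrite !(@layer_cake _ _ _ mu)//.
rewrite -ge0_integralD//=; first last.
- exact: measurable_funS (mlev _ mg).
- exact: measurable_funS (mlev _ mf).
apply: ge0_le_integral => //=.
- by move=> s _; exact: adde_ge0.
- apply: emeasurable_funD; first exact: measurable_funS (mlev _ mf).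
  exact: measurable_funS (mlev _ mg).
- exact: measurable_funS (mlev _ mh).
move=> s; rewrite in_itv/= andbT => s0.
have [sf|fs] := ltP s%:E (ereal_sup (range f)); last first.
  have f_set0 : [set x | s%:E < f x]%E = set0.
    rewrite -subset0 => x /=; rewrite ltNge => /negP; apply.
    by apply: le_trans fs; apply: ereal_sup_ubound; exists x.
  have g_set0 : [set x | s%:E < g x]%E = set0.
    rewrite -subset0 => x /=; rewrite ltNge => /negP; apply.
    by rewrite fg in fs; apply: le_trans fs; apply: ereal_sup_ubound; exists x.
  by rewrite f_set0 g_set0 !measure0 add0e.
have sg : (s%:E < ereal_sup (range g))%E by rewrite -fg.
apply: lebesgue_measure_sumset; do ?exact: measurable_superlevel.
- by have [_ [x _ <-] xs] := ereal_sup_gt sf; exists x.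
- by have [_ [x _ <-] xs] := ereal_sup_gt sg; exists x.
- exists uf => x /= sx; apply: ubf => /=.
  by apply: le_lt_trans sx; rewrite lee_fin.
- exists lg => x /= sx; apply: lbg => /=.
  by apply: le_lt_trans sx; rewrite lee_fin.
- by move=> a b /= sa sb; apply: lt_le_trans (fgh a b); rewrite lt_min sa sb.
Qed.

(** * Slicing along the first coordinate, and the weighted Brunn-Minkowski inequality *)

Section fibers.
Context {R : realType}.
Local Notation mu := (@lebesgue_measure R).
Local Notation GR := (measurableTypeR R).

Lemma cons_rVD n (p q : GR * borel_rV R n) :
  (cons_rV (p.1 + q.1, (p.2 : 'rV[R]_n) + (q.2 : 'rV[R]_n)) : 'rV[R]_n.+1) =
  (cons_rV p : 'rV[R]_n.+1) + (cons_rV q : 'rV[R]_n.+1).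
Proof.
apply/rowP => i; rewrite [in RHS]mxE.
have [j ->|->] := unliftP ord0 i; last by rewrite !cons_rV0.
by rewrite !cons_rVS mxE.
Qed.

Lemma cons_rVN n (p : GR * borel_rV R n) :
  (cons_rV (- p.1, - (p.2 : 'rV[R]_n)) : 'rV[R]_n.+1) =
  - (cons_rV p : 'rV[R]_n.+1).
Proof.
apply/rowP => i; rewrite [in RHS]mxE.
have [j ->|->] := unliftP ord0 i; last by rewrite !cons_rV0.
by rewrite !cons_rVS mxE.
Qed.

Definition fiber n (A : set (borel_rV R n.+1)) (t : R) : set (borel_rV R n) :=
  [set v | A (cons_rV (t, v))].

Let fiberE n (A : set (borel_rV R n.+1)) t :
  fiber A t = xsection (@cons_rV R n @^-1` A) t.
Proof. by apply/seteqP; split=> v; rewrite /xsection/= inE. Qed.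

Let measurable_preimage_cons n (A : set (borel_rV R n.+1)) :
  measurable A -> measurable (@cons_rV R n @^-1` A).
Proof.
by move=> mA; rewrite -[X in measurable X]setTI; exact: measurable_cons_rV.
Qed.

Lemma measurable_fiber n (A : set (borel_rV R n.+1)) t :
  measurable A -> measurable (fiber A t).
Proof.
by move=> mA; rewrite fiberE; apply: measurable_xsection;
  exact: measurable_preimage_cons.
Qed.

Lemma measurable_fun_fiber n (A : set (borel_rV R n.+1)) : measurable A ->
  measurable_fun setT (fun t : GR => lebesgue_rV (fiber A t)).
Proof.
move=> mA.
have := measurable_fun_xsection (@lebesgue_rV R n)
  (measurable_preimage_cons mA).
by congr measurable_fun; apply/funext => t /=; rewrite fiberE.
Qed.

(** Holds by unfolding, since the product measure is defined as the integral of the measures of the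
    sections. *)
Lemma lebesgue_rV_fiber n (A : set (borel_rV R n.+1)) :
  lebesgue_rV A = (\int[mu]_t lebesgue_rV (fiber A t))%E.
Proof. by apply: eq_integral => t _; rewrite /= -fiberE. Qed.

Lemma measurable_oppr_rV n (A : set (borel_rV R n)) :
  measurable A ->
  measurable ([set u | A (- (u : 'rV[R]_n))] : set (borel_rV R n)).
Proof.
have mN : measurable_fun setT
    ((fun u : 'rV[R]_n => - u) : borel_rV R n -> borel_rV R n).
  apply: (@measurability _ _ _ (borel_rV R n) _ _ (@open 'rV[R]_n) erefl).
  move=> _ [U oU <-]; rewrite setTI; apply: sub_sigma_algebra.
  by have /continuousP := @opp_continuous 'rV[R]_n; apply.
by move=> mA; rewrite -[X in measurable X]setTI; exact: mN.
Qed.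

Lemma lebesgue_rV_oppr n (A : set (borel_rV R n)) : measurable A ->
  lebesgue_rV [set u : borel_rV R n | A (- (u : 'rV[R]_n))] = lebesgue_rV A.
Proof.
elim: n A => [|n ih] A mA.
  congr lebesgue_rV; apply/seteqP; split=> u /=;
    by rewrite (_ : - _ = u)//; apply/rowP => -[].
rewrite !lebesgue_rV_fiber.
pose f := fun t : GR => lebesgue_rV (fiber A t).
have mf : measurable_fun setT f by exact: measurable_fun_fiber.
(* Negation preserves the measure of the line, so integrating against the pushforward exchanges the
   fibers at [t] and [- t]; the induction hypothesis then reflects the remaining coordinates. *)
transitivity (\int[pushforward mu (-%R : GR -> GR)]_t f t)%E.
  rewrite ge0_integral_pushforward//=.
  apply: eq_integral => t _; rewrite /f -[RHS]ih; last exact: measurable_fiber.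
  congr lebesgue_rV; apply/seteqP; split=> v /=; rewrite /fiber/=.
    by rewrite -cons_rVN.
  by rewrite -cons_rVN.
by apply: eq_measure_integral => //= B mB _; exact: lebesgue_measureN.
Qed.

Lemma measurable_cube n : measurable (cube R n : set (borel_rV R n)).
Proof.
exact: (@measurable_box_rV R n (fun=> `[-1, 1]%classic)
  (fun=> measurable_itv _)).
Qed.

Lemma lebesgue_rV_cube n :
  lebesgue_rV (cube R n : set (borel_rV R n)) = (2 ^+ n)%:E.
Proof.
transitivity (\prod_(i < n) mu `[(-1)%R, 1%R]%classic)%E.
  exact: (@lebesgue_rV_box R n (fun=> `[-1, 1]%classic)
    (fun=> measurable_itv _)).
have -> : mu `[-1, 1]%classic = 2%:E.
  rewrite lebesgue_measure_itv/= lte_fin ifT; last lra.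
  by rewrite -EFinB; congr (_%:E); lra.
by rewrite prodEFin prodr_const card_ord.
Qed.

Lemma lebesgue_rV_sub_cube n (A : set (borel_rV R n)) : measurable A ->
  A `<=` cube R n -> (lebesgue_rV A <= (2 ^+ n)%:E)%E.
Proof.
move=> mA Ac; rewrite -lebesgue_rV_cube.
by apply: le_measure => //; rewrite inE//; exact: measurable_cube.
Qed.

Lemma fiber_sub_cube n (A : set (borel_rV R n.+1)) t :
  A `<=` cube R n.+1 -> fiber A t `<=` cube R n.
Proof.
by move=> Ac v /Ac/= cv i; have := cv (lift ord0 i); rewrite cons_rVS.
Qed.

Lemma lebesgue_fiber_gt0 n (A : set (borel_rV R n.+1)) t :
  A `<=` cube R n.+1 -> (0 < lebesgue_rV (fiber A t))%E -> -1 <= t <= 1.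
Proof.
move=> Ac; have [/eqP ->|/set0P[v Av] _] := boolP (fiber A t == set0).
  by rewrite measure0 ltxx.
by have := Ac _ Av ord0; rewrite cons_rV0 in_itv.
Qed.

(** The supremum is finite because every fiber lies in a cube, and positive because otherwise all
    fibers, and hence [A], would be null. *)
Let sup_fiber n (A : set (borel_rV R n.+1)) : measurable A ->
  A `<=` cube R n.+1 -> lebesgue_rV A != 0%E ->
  exists2 a, 0 < a &
    ereal_sup (range (fun t => lebesgue_rV (fiber A t))) = a%:E.
Proof.
move=> mA Ac A0; set M := ereal_sup _.
have leM t : (lebesgue_rV (fiber A t) <= M)%E.
  by apply: ereal_sup_ubound; exists t.
have M0 : (0 < M)%E.
  rewrite lt_neqAle (le_trans (measure_ge0 _ _) (leM 0)) andbT.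
  apply: contra A0 => /eqP M0; rewrite lebesgue_rV_fiber integral0_eq// => t _.
  by apply/eqP; rewrite eq_le measure_ge0 M0 leM.
have : (M <= (2 ^+ n)%:E)%E.
  apply: ge_ereal_sup => _ [t _ <-]; apply: lebesgue_rV_sub_cube.
    exact: measurable_fiber.
  exact: fiber_sub_cube.
by case: M M0 {leM} => // a; rewrite lte_fin; exists a.
Qed.

(* Optimizing over [l] gives the multiplicative form [|C|^2 >= 4^n |A| |B|].
The induction needs the weight: with [m^2 = q / p], where [p] and [q] are the
suprema of the fiber volumes of [A] and [B], the weighted fiber volumes have the
same supremum, as [integral_minkowski_eq_sup] requires. *)
Lemma brunn_minkowski n (A B C : set (borel_rV R n)) (l : R) :
  measurable A -> measurable B -> measurable C ->
  A `<=` cube R n -> B `<=` cube R n ->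
  (forall a b : 'rV[R]_n, A a -> B b -> C (a + b)) -> 0 < l ->
  (mine ((2 ^+ n * l)%:E * lebesgue_rV A) ((2 ^+ n / l)%:E * lebesgue_rV B)
   <= lebesgue_rV C)%E.
Proof.
elim: n A B C l => [|n ih] A B C l mA mB mC Ac Bc ABC l0.
  have [->|/set0P[a Aa]] := eqVneq A set0.
    by rewrite measure0 mule0 ge_min measure_ge0.
  have [->|/set0P[b Bb]] := eqVneq B set0.
    by rewrite measure0 mule0 ge_min measure_ge0 orbT.
  (* In dimension 0 nonempty sets have measure 1, and one of [l] and [1 / l] is at most 1. *)
  have eq0 (u : 'rV[R]_0) : u = 0 by apply/rowP => -[].
  have mem0 (D : set (borel_rV R 0)) u : D u -> lebesgue_rV D = 1%E.
    by rewrite (eq0 u) => D0; rewrite /= diracE mem_set.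
  rewrite (mem0 _ _ Aa) (mem0 _ _ Bb) (mem0 _ _ (ABC _ _ Aa Bb)).
  rewrite !mule1 expr0 !mul1r ge_min !lee_fin.
  by have [//|l1] := leP l 1; rewrite invf_le1// ltW.
have [A0|A0] := eqVneq (lebesgue_rV A) 0%E.
  by rewrite A0 mule0 ge_min measure_ge0.
have [B0|B0] := eqVneq (lebesgue_rV B) 0%E.
  by rewrite B0 mule0 ge_min measure_ge0 orbT.
have [p p0 pE] := sup_fiber mA Ac A0.
have [q q0 qE] := sup_fiber mB Bc B0.
pose m := Num.sqrt (q / p).
have m0 : 0 < m by rewrite sqrtr_gt0 divr_gt0.
have twon : 0 < 2 ^+ n :> R by rewrite exprn_gt0.
pose f t := ((2 ^+ n * m)%:E * lebesgue_rV (fiber A t))%E.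
pose g t := ((2 ^+ n / m)%:E * lebesgue_rV (fiber B t))%E.
have c1 : 0 < 2 ^+ n * m by rewrite mulr_gt0.
have c2 : 0 < 2 ^+ n / m by rewrite divr_gt0.
(* Fibers of [A] at [s] and of [B] at [t] add up into the fiber of [C] at [s + t]. The induction
   hypothesis with weight [m] in place of [l] bounds the minimum of [f s] and [g t], and integration
   turns this into a bound on a sum. *)
have key : ((2 ^+ n * m)%:E * lebesgue_rV A + (2 ^+ n / m)%:E * lebesgue_rV B
    <= lebesgue_rV C)%E.
  rewrite 3!lebesgue_rV_fiber -!ge0_integralZl_EFin//; first last.
  - exact: ltW.
  - exact: measurable_fun_fiber.
  - exact: ltW.
  - exact: measurable_fun_fiber.
  apply: integral_minkowski_eq_sup => //.
  - by apply: measurable_funeM; exact: measurable_fun_fiber.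
  - by apply: measurable_funeM; exact: measurable_fun_fiber.
  - exact: measurable_fun_fiber.
  - by move=> x; rewrite mule_ge0// lee_fin ltW.
  - by move=> x; rewrite mule_ge0// lee_fin ltW.
  - exists 1 => t /=; rewrite pmule_rgt0// => /(lebesgue_fiber_gt0 Ac).
    by case/andP.
  - exists (-1) => t /=; rewrite pmule_rgt0// => /(lebesgue_fiber_gt0 Bc).
    by case/andP.
  - rewrite -[range f](image_comp _ (fun x => (2 ^+ n * m)%:E * x)%E).
    rewrite -[range g](image_comp _ (fun x => (2 ^+ n / m)%:E * x)%E).
    rewrite !ereal_sup_pZl// pE qE -!EFinM; congr (_%:E).
    have mm : m * m = q / p by rewrite -expr2 sqr_sqrtr// ltW// divr_gt0.
    have p0' : p != 0 by rewrite gt_eqF.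
    have m0' : m != 0 by rewrite gt_eqF.
    have -> : q = m * m * p by rewrite mm divfK.
    by field.
  - move=> s t; apply: ih => //;
      try exact: measurable_fiber; try exact: fiber_sub_cube.
    by move=> a b Aa Bb; have := ABC _ _ Aa Bb; rewrite -cons_rVD.
apply: le_trans key.
have real_val (D : set (borel_rV R n.+1)) : measurable D ->
    D `<=` cube R n.+1 -> exists2 a, 0 <= a & lebesgue_rV D = a%:E.
  move=> mD Dc; exists (fine (lebesgue_rV D)); first exact/fine_ge0/measure_ge0.
  rewrite fineK// ge0_fin_numE ?measure_ge0//.
  by apply: le_lt_trans (lebesgue_rV_sub_cube mD Dc) _; rewrite ltry.
have [a a0 ->] := real_val A mA Ac.
have [b b0 ->] := real_val B mB Bc.
rewrite -!EFinM -EFinD -EFin_min lee_fin.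
(* It remains to pass from weight [m] back to [l]. With [x = m / l], the two summands are at least
   [k / 2 * x] and [k / 2 * x^-1], and [x + x^-1 >= 2]. *)
set k := Num.min _ _.
have k0 : 0 <= k.
  by rewrite le_min !mulr_ge0 ?invr_ge0 ?exprn_ge0 ?(ltW l0).
have ka : k <= 2 ^+ n.+1 * l * a by rewrite ge_min lexx.
have kb : k <= 2 ^+ n.+1 / l * b by rewrite ge_min lexx orbT.
rewrite exprS in ka kb; clearbody k.
set x := m / l; have x0 : 0 < x by rewrite divr_gt0.
have h1 : k / 2 * x <= 2 ^+ n * m * a.
  have -> : 2 ^+ n * m * a = (2 * 2 ^+ n * l * a) / 2 * x.
    by rewrite /x; field; rewrite gt_eqF.
  by rewrite ler_pM2r// ler_pM2r.
have h2 : k / 2 * x^-1 <= 2 ^+ n / m * b.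
  have -> : 2 ^+ n / m * b = (2 * 2 ^+ n / l * b) / 2 * x^-1.
    by rewrite /x; field; rewrite !gt_eqF.
  by rewrite ler_pM2r ?invr_gt0// ler_pM2r.
apply: le_trans (lerD h1 h2); rewrite -mulrDr.
have : 2 <= x + x^-1.
  rewrite -subr_ge0 (_ : _ - 2 = (x - 1) ^+ 2 / x); last first.
    by field; rewrite gt_eqF.
  by rewrite divr_ge0 ?sqr_ge0 ?ltW.
by move: k0 {h1 h2}; nra.
Qed.

End fibers.

(** * Symmetric sets, and the volume bound for sum-free sets *)

Section symmetric_sets.
Context {R : realType}.

(** The orthants are closed and overlap on the coordinate hyperplanes; this is harmless, as only
    their covering of the space and subadditivity are used. *)
Definition orthant n (s : {ffun 'I_n -> bool}) : set (borel_rV R n) :=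
  [set u | forall i, (if s i then `[0, +oo[ else `]-oo, 0])%classic
                       ((u : 'rV[R]_n) 0 i)].

Lemma measurable_orthant n (s : {ffun 'I_n -> bool}) : measurable (orthant s).
Proof.
apply: (@measurable_box_rV R n
  (fun i => if s i then `[0, +oo[ else `]-oo, 0])%classic) => i.
by case: ifP => _; exact: measurable_itv.
Qed.

Lemma bigcup_orthant n : \bigcup_s (@orthant n s) = setT.
Proof.
rewrite -subTset => u _; exists [ffun i => 0 <= (u : 'rV[R]_n) 0 i] => // i.
by rewrite ffunE; case: ifPn; rewrite /= in_itv/= ?andbT// -ltNge => /ltW.
Qed.

(** Two numbers of [[-1, 1]] with the same sign differ by at most 1. *)
Lemma orthant_sub_cube n s (u v : 'rV[R]_n) : cube R n u -> cube R n v ->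
  orthant s u -> orthant s v -> cube R n (u - v).
Proof.
move=> cu cv su sv i; move: (cu i) (cv i) (su i) (sv i).
rewrite !mxE; case: ifP => _ /=; rewrite !in_itv/=; lra.
Qed.

Lemma lebesgue_rV_sub_symmetric n (E C : set (borel_rV R n)) :
  measurable E -> measurable C -> E `<=` cube R n ->
  (forall u : 'rV[R]_n, E u -> E (- u)) ->
  (forall u v : 'rV[R]_n, E u -> E v -> cube R n (u - v) -> C (u - v)) ->
  (lebesgue_rV E <= lebesgue_rV C)%E.
Proof.
move=> mE mC Ec EN EC.
have twon : 0 < 2 ^+ n :> R by rewrite exprn_gt0.
have mEs s : measurable (E `&` orthant s).
  by apply: measurableI => //; exact: measurable_orthant.
have le_s s : ((2 ^+ n)%:E * lebesgue_rV (E `&` orthant s) <= lebesgue_rV C)%E.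
  (* The reflected piece makes sums into differences. It has the same measure as the piece itself,
     so with weight [l = 1] both terms of the minimum coincide. *)
  pose B : set (borel_rV R n) := [set u | (E `&` orthant s) (- (u : 'rV[R]_n))].
  have mB : measurable B by exact: measurable_oppr_rV.
  have := @brunn_minkowski R n (E `&` orthant s) B C 1 (mEs s) mB mC.
  rewrite lebesgue_rV_oppr// mulr1 divr1 minxx; apply => //.
  - by move=> u [/Ec].
  - by move=> u [/EN]; rewrite opprK => /Ec.
  - move=> u v [Eu su] [Ev sv]; rewrite -[v]opprK; apply: EC => //.
    by apply: orthant_sub_cube su sv; exact: Ec.
have Cge0 := measure_ge0 (@lebesgue_rV R n) C.
have [Coo|Cfin] := eqVneq (lebesgue_rV C) +oo%E; first by rewrite Coo leey.
have [c cE] : exists c, lebesgue_rV C = c%:E.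
  by exists (fine (lebesgue_rV C)); rewrite fineK// ge0_fin_numE// ltey.
apply: (@le_trans _ _ (\sum_(s : {ffun 'I_n -> bool})
    lebesgue_rV (E `&` orthant s))%E).
  rewrite fsbig_seq ?index_enum_uniq//; apply: content_sub_fsum => //.
  move=> u Eu.
  have [s _ su] : (\bigcup_s orthant s) u by rewrite bigcup_orthant.
  by exists s => //=; exact: mem_index_enum.
(* There are [2 ^ n] orthants, each contributing at most [c / 2 ^ n]. *)
apply: (@le_trans _ _ (\sum_(s : {ffun 'I_n -> bool}) (c / 2 ^+ n)%:E)%E).
  by apply: lee_sum => s _; rewrite mulrC EFinM lee_pdivlMl// -cE; exact: le_s.
rewrite sumEFin sumr_const card_ffun card_bool card_ord cE lee_fin.
by rewrite -[leLHS]mulr_natr natrX divfK// gt_eqF.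
Qed.

Lemma lebesgue_rV_sum_free_le n (S : set (borel_rV R n)) : measurable S ->
  sum_free (S : set 'rV[R]_n) ->
  (lebesgue_rV (S `&` cube R n) + lebesgue_rV (S `&` cube R n)
   <= (2 ^+ n)%:E)%E.
Proof.
move=> mS sfS; have mK := @measurable_cube R n.
pose T : set (borel_rV R n) := S `&` cube R n.
pose T' : set (borel_rV R n) := [set u | T (- (u : 'rV[R]_n))].
have cubeN (u : 'rV[R]_n) : cube R n (- u) -> cube R n u.
  by move=> cu i; have := cu i; rewrite mxE !in_itv/=; lra.
have mT : measurable T by exact: measurableI.
have mT' : measurable T' by exact: measurable_oppr_rV.
pose N := cube R n `\` (T `|` T') : set (borel_rV R n).
have mN : measurable N by apply: measurableD => //; exact: measurableU.
have TT' : (lebesgue_rV (T `&` T') <= lebesgue_rV N)%E.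
  apply: lebesgue_rV_sub_symmetric => //.
  - exact: measurableI.
  - by move=> u [[]].
  - by move=> u [Tu T'u]; split=> //; rewrite /T'/= opprK.
  (* If [u - v] were in [S], then [u + (- v) = u - v] would be a forbidden sum; if [v - u] were,
     then [v + (- u) = v - u] would be one. *)
  - move=> u v [[Su _] [SNu _]] [[Sv _] [SNv _]] cuv; split=> // -[[Suv _]|[]].
      exact: (sfS _ _ _ Su SNv Suv erefl).
    by rewrite opprB => Svu _; exact: (sfS _ _ _ Sv SNu Svu erefl).
rewrite -/T -[X in (_ + X)%E](lebesgue_rV_oppr mT) -/T' -lebesgue_rV_cube.
rewrite (measureDI _ mT mT').
have mTT' : measurable (T `\` T') by exact: measurableD.
(* After [T] is split along [T'], the part [T & T'] is traded for [N]. The sets [T - T'], [N] and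
   [T'] are pairwise disjoint inside the cube, so their measures add up to at most its volume. *)
apply: (@le_trans _ _
    (lebesgue_rV (T `\` T') + lebesgue_rV N + lebesgue_rV T')%E).
  by rewrite leeD2r// leeD2l.
rewrite addeAC -measureU//; last by rewrite setDE -setIA setICl setI0.
rewrite -measureU//; last 2 first.
- exact: measurableU.
- rewrite setIC -subset0 => u [[_ nTT'] [[Tu _]|T'u]].
    by apply: nTT'; left.
  by apply: nTT'; right.
apply: le_measure; rewrite ?inE//; first by do 2! apply: measurableU => //.
move=> u [[[[_ cu] _]|[_ cu]]|[]//]; first exact: cu.
exact: cubeN.
Qed.

End symmetric_sets.

(** * The upper bound on the density, and a set attaining it *)

Theorem theorem1p1 (R : realType) (d : nat) (hd : (0 < d)%N) :
  sigma (cube R d) = (1 / 2 : R)%:E.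
Proof.
rewrite /sigma; apply/eqP; rewrite eq_le; apply/andP; split.
  apply: ge_ereal_sup => _ [S [mS sfS] <-].
  have := lebesgue_rV_sum_free_le mS sfS.
  have : (0 <= lebesgue_rV (S `&` cube R d))%E by exact: measure_ge0.
  rewrite /unif_meas lebesgue_rV_cube inver ifF; last first.
    by rewrite gt_eqF ?exprn_gt0.
  case: lebesgue_rV => [t t0|_|]//.
  rewrite -EFinD -EFinM !lee_fin ler_pdivrMr ?exprn_gt0// => tt; lra.
apply: ereal_sup_ubound.
case: d hd => // n _.
pose I := `[-1, 1]%classic : set R.
(* Two elements of [J] of equal sign sum to more than 1 in absolute value, and two of opposite sign
   to less than 1/2. Excluding the endpoints 1/2 and -1/2 matters: [1 + (- 1/2) = 1/2]. *)
pose J := (`[-1, - (1 / 2)[ `|` `]1 / 2, 1])%classic : set R.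
pose A (i : 'I_n.+1) := if i == ord0 then J else I.
have mI : measurable (I : set (measurableTypeR R)) by exact: measurable_itv.
have mJ : measurable (J : set (measurableTypeR R)).
  by apply: measurableU; exact: measurable_itv.
have mA i : measurable (A i : set (measurableTypeR R)) by rewrite /A; case: ifP.
pose S : set 'rV[R]_n.+1 := [set u | forall i, A i (u 0 i)].
have SK : S `&` cube R n.+1 = S.
  apply: setIidl => u Su i; have := Su i; rewrite /A; case: ifP => // _.
  by case=> /=; rewrite !in_itv/=; lra.
exists S.
  split; first exact: (@measurable_box_rV R n.+1 A).
  move=> a b c /(_ ord0) + /(_ ord0) + /(_ ord0) + abc.
  rewrite -abc mxE /A eqxx.
  by rewrite /J /= !in_itv/=; lra.
rewrite /unif_meas SK lebesgue_rV_cube.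
(* [J] has length 1 and each of the other [n] factors has length 2, which is half of the volume
   [2 ^ n.+1] of the cube. *)
have -> : lebesgue_rV S = (2 ^+ n)%:E.
  transitivity (\prod_(i < n.+1) lebesgue_measure (A i))%E.
    exact: (@lebesgue_rV_box R n.+1 A).
  rewrite big_ord_recl /A eqxx.
  under eq_bigr do rewrite (_ : (_ == _) = false)//.
  rewrite [X in (X * _)%E](_ : _ = 1%E); last first.
    rewrite measureU//; first last.
    - by rewrite -subset0 => x [] /=; rewrite !in_itv/=; lra.
    rewrite /= !lebesgue_measure_itv/= !lte_fin !ifT; [|lra|lra].
    by rewrite -!EFinB -EFinD; congr (_%:E); lra.
  rewrite mul1e -lebesgue_rV_cube.
  exact/esym/(@lebesgue_rV_box R n (fun=> I)).
rewrite inver ifF; last by rewrite gt_eqF ?exprn_gt0.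
rewrite -EFinM exprS; congr (_%:E); field.
by rewrite expf_neq0.
Qed.
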